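(* Let $q=1+16a^2$ be a prime power with $a$ a positive integer, $\gamma$ a primitive element of $\mathbb{F}_q$, $l=\frac{q-1}{4}$, and let $G$ be the group on $\mathbb{F}_q\times\mathbb{Z}_l$ with multiplication $(x,i)(y,j)=(x+\gamma^{4i}y,\ i+j)$. Let $S=\{-1+x: x\in D_2^4\}$ and $E=\{(x,i): x\in S,\ i\in\mathbb{Z}_l\}$. Then $\mathrm{Cay}(G,E)$ is a directed strongly regular graph with parameters $\left(\frac{q(q-1)}{4},\ \left(\frac{q-1}{4}\right)^2,\ \left(\frac{q-1}{8}\right)^2,\ \left(\frac{q-1}{8}\right)^2-\frac{q-1}{16},\ \left(\frac{q-1}{8}\right)^2\right)$.
   Context: The cyclotomic classes of order $e$ (for $e\mid q-1$) with respect to the primitive element $\gamma$ are $D_i^e=\gamma^i\langle\gamma^e\rangle$, $i=0,\dots,e-1$. The Cayley digraph $\mathrm{Cay}(G,E)$ has vertex set $G$ and an arc $g\to h$ iff $g^{-1}h\in E$. A directed strongly regular graph with parameters $(v,k,t,\lambda,\mu)$ is a digraph (no loops, no multiple arcs) on $v$ vertices whose adjacency matrix $A$ satisfies $A^2=tI+\lambda A+\mu(J-I-A)$ and $AJ=JA=kJ$. (The paper's printed set ''$-1+D_2^2\cup\{0\}$'' is a misprint; the class $D_2^4$ is what its proof and parameters use.) *)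

(* Defs.v *)
From HB Require Import structures.
From mathcomp Require Import all_boot all_order all_algebra all_field.
Set Implicit Arguments. Unset Strict Implicit. Unset Printing Implicit Defensive.
Import GRing.Theory.
Local Open Scope ring_scope.

(* Cyclotomic class D_i^e = gamma^i <gamma^e> in F^* (gamma primitive, e | q-1). *)
Definition cyc_class (F : finFieldType) (gamma : F) (e i : nat) : {set F} :=
  [set x | [exists k : 'I_#|F|, x == gamma ^+ (i + e * k)%N]].

Definition Gmul (F : finFieldType) (gamma : F) (l : nat)
  (g h : F * 'Z_l) : F * 'Z_l :=
  (g.1 + gamma ^+ (4 * g.2)%N * h.1, g.2 + h.2).

Definition Ginv (F : finFieldType) (gamma : F) (l : nat)
  (g : F * 'Z_l) : F * 'Z_l :=
  (- (gamma ^+ (4 * g.2)%N)^-1 * g.1, - g.2).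

Definition cay_arc (F : finFieldType) (gamma : F) (l : nat)
  (E : {set F * 'Z_l}) : rel (F * 'Z_l) :=
  fun g h => Gmul gamma (Ginv gamma g) h \in E.

(* Directed strongly regular graph with parameters (v,k,t,lambda,mu):
   no loops, and entrywise  A^2 = tI + lambda A + mu (J - I - A),
   AJ = JA = kJ. *)
Definition is_dsrg (V : finType) (adj : rel V) (v k t lam mu : nat) : Prop :=
  [/\ #|V| = v,
      (forall x, ~~ adj x x),
      (forall x, #|[set y | adj x y]| = k),
      (forall y, #|[set x | adj x y]| = k) &
      (forall x y, #|[set z | adj x z && adj z y]| =
          if x == y then t else if adj x y then lam else mu)].

(* Main.v *)
Require Import Defs.
From HB Require Import structures.
From mathcomp Require Import all_boot all_order all_algebra all_field.
From mathcomp Require Import zify ring.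
Import Order.TTheory GRing.Theory Num.Theory.
Local Open Scope ring_scope.

Set Implicit Arguments.
Unset Strict Implicit.
Unset Printing Implicit Defensive.

(** There is an arc from [(x, i)] to [(y, j)] iff [y - x + gamma^(4i)] lies in
    [D_2], so the number of 2-paths is the number of ways to write
    [d = y - x + gamma^(4i)] as [u + v + c] with [u, v] in [D_2] and [c] in
    [D_0].  Everything follows once each nonzero [d] is a sum of an element of
    [D_0] and one of [D_2] in exactly [a^2] ways.  With [phi] the quadratic
    character and [S k] the Jacobsthal sum of [phi x * phi (x^2 + k)], this
    number is [(q - 1 - phi d * (2 + S 1)) / 16], so the claim is [S 1 = -2].
    Now [(S 1 / 2)^2 + (S gamma / 2)^2 = q = 1^2 + (4a)^2]; the characteristic
    does not divide [S 1], which is minus the binomial coefficient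
    [C((q-1)/2, (q-1)/4)] in [F], so the two representations of [q] agree up to
    order and signs, and [S 1 = -2 mod 16] leaves only [S 1 = -2]. *)

(** * Arithmetic of primes congruent to 1 mod 4 and sums of two squares *)

Lemma expn_mod4_eq1 (p n : nat) : (p %% 4 = 1 -> p ^ n %% 4 = 1)%N.
Proof. by move=> p1; rewrite -modnXm p1 exp1n. Qed.

(** For [k <= n], both [p ^ k] and [p ^ (n - k)] are 1 mod 4, so [l] leaves the remainder
    [(p ^ k - 1) / 4] modulo [p ^ k], less than half the modulus; for larger [k] both quotients are
    0. *)
Lemma divn_double_expn (p n k l : nat) :
  (p %% 4 = 1 -> p ^ n = (4 * l).+1 -> (2 * l) %/ p ^ k = 2 * (l %/ p ^ k))%N.
Proof.
move=> p1 pn; have p_gt0 : (0 < p)%N by lia.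
have pk_gt0 : (0 < p ^ k)%N by rewrite expn_gt0 p_gt0.
have [le_kn|lt_nk] := leqP k n; last first.
  have [l0|l_gt0] := posnP l; first by rewrite l0 !div0n.
  have p_gt1 : (1 < p)%N by case: p p_gt0 pn {p1 pk_gt0} => [|[|]] // _; rewrite exp1n; lia.
  have : (p ^ n < p ^ k)%N by rewrite ltn_exp2l.
  by move=> lt_p; rewrite !divn_small; lia.
move: pn; rewrite -(subnKC le_kn) expnD.
have := expn_mod4_eq1 k p1; have := expn_mod4_eq1 (n - k) p1.
move: (p ^ (n - k))%N (p ^ k)%N pk_gt0 => P Q Q_gt0 P1 Q1 PQ.
have [w defP] : exists w, P = (4 * w + 1)%N by exists (P %/ 4)%N; lia.
have [u defQ] : exists u, Q = (4 * u + 1)%N by exists (Q %/ 4)%N; lia.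
have defl : l = (w * Q + u)%N by subst P Q; nia.
have def2l : (2 * l = 2 * w * Q + 2 * u)%N by rewrite defl; lia.
by rewrite def2l defl !divnMDl // !divn_small; lia.
Qed.

(* Legendre's formula: doubling [l] produces no carry in base [p]. *)
Lemma prime_ndvd_central_bin (p n l : nat) :
  prime p -> (p %% 4 = 1)%N -> (p ^ n = (4 * l).+1)%N -> ~~ (p %| 'C(2 * l, l))%N.
Proof.
move=> p_pr p1 pn.
have bin_gt : (0 < 'C(2 * l, l))%N by rewrite bin_gt0; lia.
have := bin_fact (_ : l <= 2 * l)%N => /(_ ltac:(lia)).
rewrite (_ : (2 * l - l = l)%N); last by lia.
move/(congr1 (logn p)); rewrite !lognM ?muln_gt0 ?fact_gt0 // !logn_fact //.
have ext : (\sum_(1 <= k < (2 * l).+1) l %/ p ^ k =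
            \sum_(1 <= k < l.+1) l %/ p ^ k)%N.
  rewrite (big_cat_nat (n := l.+1)) //=; last by lia.
  rewrite -[RHS]addn0; congr addn.
  rewrite big_nat_cond big1 // => k /andP[/andP[lt_lk _] _].
  by rewrite divn_small // (leq_trans lt_lk) // ltnW // ltn_expl // prime_gt1.
under [RHS]eq_bigr => k _ do rewrite (divn_double_expn k p1 pn).
rewrite -big_distrr /= ext => eq_log.
have log0 : logn p 'C(2 * l, l) = 0%N by lia.
by apply/negP => dvd_p; have := logn_gt0 p 'C(2 * l, l); rewrite mem_primes p_pr bin_gt dvd_p log0.
Qed.

(** The image of [m] in [K] is a square root of -1. If [p] were 3 mod 4, then [m ^ p = m ^ 3 = - m],
    while Frobenius fixes [m]; so [p] would divide [2 * m]. *)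
Lemma pchar_dvd_sqrD1_mod4 (K : fieldType) (p m : nat) :
  p \in [pchar K] -> odd p -> (p %| m ^ 2 + 1)%N -> (p %% 4 = 1)%N.
Proof.
move=> chK p_odd p_dvd; have p_pr := pcharf_prime chK.
 apply/eqP/negPn/negP => p1.
have p3 : (p = 4 * (p %/ 4) + 3)%N by lia.
have sqr_m : (m%:R : K) ^+ 2 = -1.
  apply/eqP; rewrite -addr_eq0 -natrX -[1]/(1%:R) -natrD.
  by rewrite -(dvdn_pcharf chK).
have : (m%:R : K) ^+ p = m%:R by have := pFrobenius_aut_nat chK m.
rewrite [X in _ ^+ X]p3 exprD exprM (exprM _ 2 2) sqr_m sqrrN expr1n expr1n mul1r exprS sqr_m.
move/eqP; rewrite mulrN1 eq_sym -subr_eq0 opprK -mulr2n -mulrnA.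
rewrite -(dvdn_pcharf chK) Euclid_dvdM // => /orP[pm|].
  by move: p_dvd; rewrite dvdn_addr ?expnS ?dvdn_mulr // dvdn1 => /eqP p1'; rewrite p1' in p_pr.
by move/dvdn_leq => /(_ isT); case: p p_odd p_pr {p_dvd p1 p3 chK sqr_m} => [|[|[|]]].
Qed.

Lemma prime_dvdzM (p : nat) (x y : int) : prime p ->
  (p%:Z %| x * y)%Z = (p%:Z %| x)%Z || (p%:Z %| y)%Z.
Proof. by move=> p_pr; rewrite !dvdzE abszM Euclid_dvdM. Qed.

(* The Brahmagupta identity makes [q ^ 2] a sum of two squares, one of them
   divisible by [q ^ 2]. *)
Lemma sum_two_squares_unique (p n : nat) (b s t : int) : prime p ->
  (p ^ n)%N%:Z = 1 + b ^+ 2 -> s ^+ 2 + t ^+ 2 = (p ^ n)%N%:Z ->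
  ~~ (p%:Z %| 2)%Z -> ~~ (p%:Z %| s)%Z -> s ^+ 2 = 1 \/ s ^+ 2 = b ^+ 2.
Proof.
move=> p_pr; set q := (p ^ n)%N%:Z => defq st p2 ps.
have q_gt0 : 0 < q by rewrite /q ltz_nat expn_gt0 prime_gt0.
have npb : (0 < n)%N -> ~~ (p%:Z %| b)%Z.
  move=> n_gt0; apply/negP => pb.
  have : (p%:Z %| q - b ^+ 2)%Z.
    rewrite rpredB //; last by rewrite expr2 dvdz_mulr.
    by rewrite /q dvdzE /= dvdn_exp.
  have -> : q - b ^+ 2 = 1 by rewrite defq; ring.
  by rewrite dvdzE /= dvdn1 => /eqP p1; rewrite p1 in p_pr.
have dvd_prod : (q %| (b * s - t) * (b * s + t))%Z.
  have -> : (b * s - t) * (b * s + t) = q * (s ^+ 2 - 1).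
    have -> : (b * s - t) * (b * s + t) = b ^+ 2 * s ^+ 2 - t ^+ 2 by ring.
    have -> : t ^+ 2 = q - s ^+ 2 by rewrite -st; ring.
    have -> : b ^+ 2 = q - 1 by rewrite defq; ring.
    by ring.
  exact: dvdz_mulr.
(* For [n > 0] the sum [2 * (b * s)] of the two factors is prime to [p], so one factor is coprime to
   [q] and the other absorbs all of [q]. *)
have dvd_t : (q %| b * s - t)%Z \/ (q %| b * s + t)%Z.
  have cop x : ~~ (p%:Z %| x)%Z -> coprimez q x.
    by move=> px; rewrite coprimezE /q /= coprimeXl // prime_coprime.
  have [px|px] := boolP (p%:Z %| b * s - t)%Z; last first.
    by right; rewrite -(Gauss_dvdzr _ (cop _ px)).
  have [py|py] := boolP (p%:Z %| b * s + t)%Z; last first.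
    by left; rewrite -(Gauss_dvdzl _ (cop _ py)).
  have [n0|/npb pb] := posnP n; first by left; rewrite /q n0 expn0 dvd1z.
  have : (p%:Z %| (b * s - t) + (b * s + t))%Z by rewrite rpredD.
  have -> : (b * s - t) + (b * s + t) = 2 * (b * s) by ring.
  by rewrite !prime_dvdzM // (negPf p2) (negPf ps) (negPf pb).
wlog dvd_m : t st {dvd_prod dvd_t} dvd_t / (q %| b * s - t)%Z => [hw|].
  case: (dvd_t) => [|dvd_p]; first exact: hw.
  apply: (hw (- t)); first by rewrite sqrrN.
    by left; rewrite opprK.
  by rewrite opprK.
have {dvd_t} [m defm] : exists m, b * s - t = m * q by case/dvdzP: dvd_m => m; exists m.
have brahma : (s + b * t) ^+ 2 + (m * q) ^+ 2 = q ^+ 2.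
  rewrite -defm; transitivity ((1 + b ^+ 2) * (s ^+ 2 + t ^+ 2)); first by ring.
  by rewrite -defq st expr2.
have q_neq0 : q != 0 by rewrite lt0r_neq0.
have m_le1 : m ^+ 2 <= 1.
  rewrite -(ler_pM2r (exprn_gt0 2 q_gt0)) mul1r -exprMn -brahma.
  by rewrite lerDr sqr_ge0.
(* If [m = 0] then [t = b * s] and [q = s ^ 2 * q]; if [m ^ 2 = 1] then [s = - (b * t)] and
   [q = t ^ 2 * q]. *)
have [m0|m2] : m ^+ 2 = 0 \/ m ^+ 2 = 1 by have := sqr_ge0 m; lia.
  move/eqP: m0; rewrite sqrf_eq0 => /eqP m0.
  have bst : t = b * s by apply/esym/subr0_eq; rewrite defm m0 mul0r.
  left; apply: (mulfI q_neq0); rewrite mulr1 -[RHS]st {1}defq bst; ring.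
have : (s + b * t) ^+ 2 == 0.
  by rewrite -[X in _ == X](subrr (q ^+ 2)) -{1}brahma exprMn m2 mul1r addrK.
rewrite sqrf_eq0 addr_eq0 => /eqP sbt.
have t2 : t ^+ 2 = 1 by apply: (mulfI q_neq0); rewrite mulr1 -[RHS]st {1}defq sbt; ring.
right; by rewrite sbt sqrrN exprMn t2 mulr1.
Qed.

(** * The quadratic character and Jacobsthal sums *)

Section QuadraticCharacter.
Variables (F : finFieldType) (h : nat) (gamma : F).
Hypothesis cardF : #|F| = (2 * h).+1.
Hypothesis prim_gamma : (2 * h).-primitive_root gamma.

(** Euler's criterion with [h = (q - 1) / 2]; the values lie in [int] rather than [F], so that
    character sums keep their exact size. *)
Definition qchar (x : F) : int :=
  if x == 0 then 0 else if x ^+ h == 1 then 1 else -1.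

Local Notation phi := qchar.

Lemma half_gt0 : (0 < h)%N.
Proof. by have := prim_order_gt0 prim_gamma; lia. Qed.

Lemma expf_cardB1 (x : F) : x != 0 -> x ^+ (2 * h) = 1.
Proof.
by move=> x0; apply: (mulIf x0); rewrite mul1r -exprSr -cardF expf_card.
Qed.

Lemma prim_neq0 : gamma != 0.
Proof.
apply/eqP => g0; have := prim_expr_order prim_gamma.
by rewrite g0 expr0n muln_eq0 /= (gtn_eqF half_gt0) => /eqP; rewrite eq_sym oner_eq0.
Qed.

Lemma oppr1_neq1 : -1 != 1 :> F.
Proof.
apply/negP => /eqP opp1; have := prim_order_dvd prim_gamma h.
rewrite gtnNdvd ?half_gt0 //; last by have := half_gt0; lia.
have /eqP := expf_cardB1 prim_neq0; rewrite mulnC exprM sqrf_eq1 opp1 orbb.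
by move=> ->.
Qed.

Lemma natr2_neq0 : 2%:R != 0 :> F.
Proof.
by apply: contra oppr1_neq1; rewrite mulr2n addr_eq0 eq_sym.
Qed.

Lemma expf_half (x : F) : x != 0 -> (x ^+ h == 1) || (x ^+ h == -1).
Proof. by move=> /expf_cardB1 /eqP; rewrite mulnC exprM sqrf_eq1. Qed.

Lemma qchar0 : phi 0 = 0.
Proof. by rewrite /phi eqxx. Qed.

Lemma qchar1 : phi 1 = 1.
Proof. by rewrite /phi oner_eq0 expr1n eqxx. Qed.

Lemma qchar_intr (x : F) : (phi x)%:~R = x ^+ h :> F.
Proof.
rewrite /phi; case: eqVneq => [->|x0].
  by rewrite expr0n (gtn_eqF half_gt0).
case: eqP => [->//|/eqP x1]; have := expf_half x0.
by rewrite (negPf x1) => /eqP ->.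
Qed.

Lemma qchar_cases (x : F) : [\/ phi x = 0, phi x = 1 | phi x = -1].
Proof.
by rewrite /phi; case: ifP => _; [constructor 1|case: ifP => _; [constructor 2|constructor 3]].
Qed.

(** Since [-1 != 1] in [F], the integers 0, 1 and -1 stay distinct there; identities such as
    multiplicativity thus reduce to [h]-th powers in [F]. *)
Lemma qchar_unique (x : F) (m : int) :
  [\/ m = 0, m = 1 | m = -1] -> m%:~R = x ^+ h -> phi x = m.
Proof.
rewrite -qchar_intr.
case: (qchar_cases x) => -> [] -> //= /eqP; rewrite ?mulrNz ?mulr1z ?mulr0z.
- by rewrite oner_eq0.
- by rewrite oppr_eq0 oner_eq0.
- by rewrite eq_sym oner_eq0.
- by rewrite (negPf oppr1_neq1).
- by rewrite eq_sym oppr_eq0 oner_eq0.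
- by rewrite eq_sym (negPf oppr1_neq1).
Qed.

Lemma qcharM (x y : F) : phi (x * y) = phi x * phi y.
Proof.
apply: qchar_unique; last by rewrite intrM !qchar_intr exprMn.
by case: (qchar_cases x) => ->; case: (qchar_cases y) => ->;
  rewrite ?mulr0 ?mul0r ?mul1r ?mulr1 ?mulrN1 ?opprK;
  (constructor 1 + constructor 2 + constructor 3).
Qed.

Lemma qchar_neq0 (x : F) : x != 0 -> phi x ^+ 2 = 1.
Proof. by rewrite /phi => /negPf ->; case: ifP. Qed.

Lemma qchar_sqr (x : F) : x != 0 -> phi (x ^+ 2) = 1.
Proof. by move=> x0; rewrite expr2 qcharM -expr2 qchar_neq0. Qed.

Lemma qcharV (x : F) : phi x^-1 = phi x.
Proof.
have [->|x0] := eqVneq x 0; first by rewrite invr0.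
have xx : phi x * phi x^-1 = 1 by rewrite -qcharM divff // qchar1.
by rewrite -[LHS]mul1r -(qchar_neq0 x0) expr2 -mulrA xx mulr1.
Qed.

Lemma qchar_prim : phi gamma = -1.
Proof.
rewrite /phi (negPf prim_neq0) -(prim_order_dvd prim_gamma) gtnNdvd ?half_gt0 //.
by have := half_gt0; lia.
Qed.

Lemma qchar1_root (x : F) : phi x = 1 -> exists y, y ^+ 2 = x.
Proof.
rewrite /phi; case: eqVneq => // x0; case: eqP => // xh _.
have [i defx] := prim_rootP prim_gamma (expf_cardB1 x0).
move: xh; rewrite defx -exprM => /eqP; rewrite -(prim_order_dvd prim_gamma).
rewrite dvdn_pmul2r ?half_gt0 // => i2.
by exists (gamma ^+ (i %/ 2)); rewrite -exprM divnK.
Qed.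

Lemma sum_sqr_roots (T : zmodType) (f : F -> T) (x : F) : x != 0 ->
  \sum_(y | y ^+ 2 == x ^+ 2) f y = f x + f (- x).
Proof.
move=> x0; have xNx : - x != x.
  by rewrite -subr_eq0 -opprD oppr_eq0 -mulr2n -mulr_natl mulf_neq0 ?natr2_neq0.
rewrite (bigD1 x) //= (bigD1 (- x)) ?sqrrN ?eqxx //= big1 ?addr0 // => y.
by rewrite eqf_sqr => /andP[/andP[/orP[]->]].
Qed.

Lemma card_sqr_roots (x : F) : \sum_(y | y ^+ 2 == x) 1 = 1 + phi x :> int.
Proof.
have [->|x0] := eqVneq x 0.
  rewrite qchar0 (big_pred1 0) // => y; exact: sqrf_eq0.
case: (qchar_cases x) => phix.
- by have := qchar_neq0 x0; rewrite phix expr0n.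
- have [y defx] := qchar1_root phix; rewrite -{1}defx sum_sqr_roots ?phix //.
  by apply: contra x0 => /eqP y0; rewrite -defx y0 expr0n.
rewrite phix big1 // => y /eqP defx; have : phi x ^+ 2 = 1 by rewrite phix.
have y0 : y != 0 by apply: contra x0 => /eqP y0; rewrite -defx y0 expr0n.
by move: phix; rewrite -defx qchar_sqr.
Qed.

Lemma sum_fiber_sqr (T : comNzRingType) (f : F -> T) :
  \sum_x f (x ^+ 2) = \sum_z (1 + (phi z)%:~R) * f z.
Proof.
rewrite (partition_big (fun x => x ^+ 2) xpredT) //=; apply: eq_bigr => z _.
rewrite (eq_bigr (fun _ => f z * 1)); last by move=> x /eqP ->; rewrite mulr1.
rewrite -big_distrr /= mulrC; congr (_ * _).
have /(congr1 (fun m : int => m%:~R : T)) := card_sqr_roots z.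
by rewrite rmorph_sum /= rmorphD /=.
Qed.

Lemma sum_qchar : \sum_x phi x = 0.
Proof.
have : \sum_x phi x = - \sum_x phi x; last by lia.
rewrite {1}(reindex_inj (mulfI prim_neq0)) /= -sumrN.
by apply: eq_bigr => x _; rewrite qcharM qchar_prim mulN1r.
Qed.

Lemma sum_qchar_shift (c : F) : \sum_x phi (x + c) = 0.
Proof. by rewrite -[RHS]sum_qchar [RHS](reindex_inj (addIr c)). Qed.

Lemma sum_qchar_sqr : \sum_x phi x ^+ 2 = (2 * h)%:R.
Proof.
rewrite (bigD1 0) //= qchar0 expr0n add0r.
rewrite (eq_bigr (fun _ => 1)) => [|x /qchar_neq0 //].
rewrite sumr_const; congr (_ *+ _).
by rewrite cardC1 cardF.
Qed.

(** For nonzero [x] the term equals [phi (1 + c / x)], and [c / x] runs over all nonzero elements;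
    what remains is the full sum of [phi], which is 0, minus [phi 1]. *)
Lemma sum_qcharM_shift (c : F) : c != 0 -> \sum_x phi x * phi (x + c) = -1.
Proof.
move=> c0; rewrite (bigD1 0) //= qchar0 mul0r add0r.
have := sum_qchar; rewrite (reindex_inj (addrI 1)) (bigD1 0) //= addr0 qchar1.
move=> /(canRL (addKr _)); rewrite addr0 => <-.
rewrite (reindex_inj (mulfI c0)) /= (reindex_inj invr_inj) /=.
apply: eq_big => [x|x]; rewrite mulf_eq0 (negPf c0) invr_eq0 // => x0.
have -> : c * x^-1 + c = c * x^-1 * (1 + x) by field.
by rewrite (qcharM (c / x)) mulrA -expr2 qchar_neq0 ?mul1r // mulf_neq0 ?invr_eq0.
Qed.

Lemma sum_qchar_correlation (b c : F) :
  \sum_k phi (b + k) * phi (c + k) = (b == c)%:R * (2 * h).+1%:R - 1.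
Proof.
transitivity (\sum_k phi k * phi (k + (c - b))).
  rewrite [RHS](reindex_inj (addrI b)) /=; apply: eq_bigr => k _.
  by congr (_ * phi _); ring.
have [->|bc] := eqVneq; last by rewrite sum_qcharM_shift ?subr_eq0 1?eq_sym // mul0r.
rewrite subrr mul1r -natr1 addrK -sum_qchar_sqr.
by apply: eq_bigr => k _; rewrite addr0.
Qed.

Lemma natr_cardF : #|F|%:R = 0 :> F.
Proof.
have : \sum_(x : F) x = \sum_(x : F) (x + 1) by rewrite {1}(reindex_inj (addIr 1)).
by rewrite big_split /= sumr_const -{1}[\sum_x x]addr0 => /addrI/esym.
Qed.

(** Substituting [gamma * x] multiplies the sum by [gamma ^ k], so it vanishes unless
    [gamma ^ k = 1]; in that case the [q - 1] nonzero [x] contribute 1 each. *)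
Lemma sum_expf (k : nat) : (0 < k)%N ->
  \sum_(x : F) x ^+ k = if (2 * h %| k)%N then -1 else 0.
Proof.
move=> k_gt0; case: ifPn => [/dvdnP[m def_k]|].
  rewrite (bigD1 0) //= expr0n (gtn_eqF k_gt0).
  rewrite add0r (eq_bigr (fun _ => 1)) => [|x x0]; last first.
    by rewrite def_k mulnC exprM expf_cardB1 ?expr1n.
  by apply/eqP; rewrite sumr_const cardC1 -addr_eq0 natr1 cardF -cardF natr_cardF.
rewrite (prim_order_dvd prim_gamma) => gk.
have : gamma ^+ k * \sum_(x : F) x ^+ k = \sum_(x : F) x ^+ k.
  rewrite [RHS](reindex_inj (mulfI prim_neq0)) big_distrr /=.
  by apply: eq_bigr => x _; rewrite exprMn.
move/eqP; rewrite -subr_eq0 -{2}[\sum_x _]mul1r -mulrBl mulf_eq0 subr_eq0.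
by rewrite (negPf gk) => /eqP.
Qed.

Definition jacobsthal (k : F) : int := \sum_x phi x * phi (x ^+ 2 + k).

Local Notation S := jacobsthal.

(** Substitution of [m * x] for [x]. Up to sign, [S k] thus depends only on the square class of
    [k]. *)
Lemma jacobsthal_sqrM (k m : F) : m != 0 -> S (k * m ^+ 2) = phi m * S k.
Proof.
move=> m0; rewrite /S (reindex_inj (mulfI m0)) /= big_distrr /=.
apply: eq_bigr => x _; rewrite exprMn [k * _]mulrC -mulrDr (qcharM m).
by rewrite (qcharM (m ^+ 2)) qchar_sqr // mul1r mulrA.
Qed.

Lemma jacobsthal0 : S 0 = 0.
Proof.
rewrite /S -[RHS]sum_qchar; apply: eq_bigr => x _; rewrite addr0.
by have [->|x0] := eqVneq x 0; rewrite ?qchar0 ?mul0r // qchar_sqr // mulr1.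
Qed.

(** The two coefficients are 2 and 0 at nonzero squares, 0 and 2 at nonsquares; a single formula in
    [phi k] makes the sum over all [k] computable. *)
Lemma jacobsthal_sqr (k : F) : 2 * S k ^+ 2 =
  (phi k ^+ 2 + phi k) * S 1 ^+ 2 + (phi k ^+ 2 - phi k) * S gamma ^+ 2.
Proof.
have [->|k0] := eqVneq k 0; first by rewrite qchar0 jacobsthal0; ring.
case: (qchar_cases k) => phik.
- by have := qchar_neq0 k0; rewrite phik expr0n.
- have [m defk] := qchar1_root phik.
  have m0 : m != 0 by apply: contra k0 => /eqP m0; rewrite -defk m0 expr0n.
  rewrite phik -{1}defk -[m ^+ 2]mul1r jacobsthal_sqrM // exprMn qchar_neq0 //.
  by ring.
have [m defk] : exists m, m ^+ 2 = k * gamma^-1.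
  by apply: qchar1_root; rewrite qcharM phik qcharV qchar_prim.
have {}defk : k = gamma * m ^+ 2 by rewrite defk mulrCA divff ?prim_neq0 ?mulr1.
have m0 : m != 0 by apply: contra k0 => /eqP m0; rewrite defk m0 expr0n mulr0.
by rewrite phik {1}defk jacobsthal_sqrM // exprMn qchar_neq0 //; ring.
Qed.

Hypothesis even_h : ~~ odd h.

Lemma qcharN (x : F) : phi (- x) = phi x.
Proof.
rewrite -mulN1r qcharM (_ : phi (-1) = 1) ?mul1r //.
by rewrite /phi oppr_eq0 oner_eq0 -signr_odd (negPf even_h) expr0 eqxx.
Qed.

(** Expanding the square and summing over [k] first, orthogonality keeps only [y = x] and [y = - x];
    as [h] is even, [phi (- x) = phi x], so both contribute alike. *)
Lemma sum_jacobsthal_sqr : \sum_k S k ^+ 2 = (2 * (2 * h).+1 * (2 * h))%:R.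
Proof.
transitivity (\sum_x \sum_y phi x * phi y *
   ((x ^+ 2 == y ^+ 2)%:R * (2 * h).+1%:R - 1)).
  under eq_bigr => k _ do rewrite expr2 /S big_distrlr /=.
  rewrite exchange_big /=; apply: eq_bigr => x _.
  rewrite exchange_big /=; apply: eq_bigr => y _.
  rewrite -sum_qchar_correlation big_distrr /=.
  by apply: eq_bigr => k _; rewrite mulrACA.
transitivity (\sum_x phi x ^+ 2 * (2 * (2 * h).+1)%:R); last first.
  by rewrite -big_distrl /= sum_qchar_sqr -natrM mulnC.
apply: eq_bigr => x _; rewrite (eq_bigr (fun y => phi x * (2 * h).+1%:R *
   (if y ^+ 2 == x ^+ 2 then phi y else 0) - phi x * phi y)); last first.
  by move=> y _; rewrite eq_sym; case: eqP => _ /=; ring.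
rewrite sumrB -!big_distrr /= sum_qchar mulr0 subr0 -big_mkcond /=.
have [->|x0] := eqVneq x 0; first by rewrite qchar0; ring.
by rewrite sum_sqr_roots // qcharN natrM; ring.
Qed.

Lemma jacobsthal_sum_squares : S 1 ^+ 2 + S gamma ^+ 2 = 4 * (2 * h).+1%:R.
Proof.
have : 2 * \sum_k S k ^+ 2 = (2 * h)%:R * (S 1 ^+ 2 + S gamma ^+ 2).
  rewrite big_distrr /=; under eq_bigr => k _ do rewrite jacobsthal_sqr.
  rewrite big_split /= -!big_distrl /= sumrB big_split /= sum_qchar sum_qchar_sqr.
  by ring.
rewrite sum_jacobsthal_sqr => eqS.
apply: (mulfI (_ : (2 * h)%:R != 0)); last by rewrite -eqS !natrM; ring.
by rewrite pnatr_eq0 muln_eq0 /= (gtn_eqF half_gt0).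
Qed.

End QuadraticCharacter.

(** * Quartic classes and the number of representations as a sum of two of them *)

Section QuarticClasses.
Variables (F : finFieldType) (l : nat) (gamma : F).
Hypothesis cardF : #|F| = (2 * (2 * l)).+1.
Hypothesis prim_gamma : (2 * (2 * l)).-primitive_root gamma.

Local Notation phi := (@qchar F (2 * l)).
Local Notation S := (@jacobsthal F (2 * l)).

Let intrE := qchar_intr cardF prim_gamma.
Let phiM := qcharM cardF prim_gamma.

Let phiN : forall x, phi (- x) = phi x.
Proof. by apply: (qcharN cardF prim_gamma); rewrite oddM. Qed.

Lemma quarter_gt0 : (0 < l)%N.
Proof. by have := half_gt0 cardF prim_gamma; lia. Qed.

Lemma expr_prim_half : gamma ^+ (2 * l) = -1.
Proof. by rewrite -intrE (qchar_prim cardF prim_gamma). Qed.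

Lemma qchar_eq (e : int) (x : F) : e = 1 \/ e = -1 ->
  (phi x == e) = (x ^+ (2 * l) == e%:~R).
Proof.
move=> e1; apply/eqP/eqP => [<-|]; first by rewrite intrE.
by move/esym; apply: (qchar_unique cardF prim_gamma); case: e1 => ->; [constructor 2|constructor 3].
Qed.

(** The summand is twice the indicator of [phi y = e]. The roots [y] and [- y] of a nonzero square
    [v] share the value [phi y], which is [v ^ l] in [F]; a nonsquare has [v ^ (2 * l) = -1], so
    [v ^ l] is not [e]. *)
Lemma sum_roots_quartic (e : int) (v : F) : e = 1 \/ e = -1 ->
  \sum_(y | y ^+ 2 == v) (phi y ^+ 2 + e * phi y) = 4 * (v ^+ l == e%:~R)%:R.
Proof.
move=> e1; have e2 : (e%:~R : F) ^+ 2 = 1 by case: e1 => ->; rewrite ?mulrNz ?sqrrN expr1n.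
have [->|v0] := eqVneq v 0.
  rewrite (big_pred1 0) => [|y]; last exact: sqrf_eq0.
  rewrite qchar0 mulr0 addr0 !expr0n (gtn_eqF quarter_gt0) /=.
  case: eqP e2 => [<-|]; last by rewrite mulr0.
  by rewrite expr0n /= => /eqP; rewrite eq_sym oner_eq0.
case: (qchar_cases (2 * l) v) => phiv.
- by have := qchar_neq0 (2 * l) v0; rewrite phiv expr0n.
- have [y defv] := qchar1_root cardF prim_gamma phiv; rewrite -defv.
  have y0 : y != 0 by apply: contra v0 => /eqP y0; rewrite -defv y0 expr0n.
  rewrite (sum_sqr_roots cardF prim_gamma) // -exprM -qchar_eq //.
  have -> : phi (- y) ^+ 2 + e * phi (- y) = phi y ^+ 2 + e * phi y.
    by rewrite phiN.
  rewrite !qchar_neq0 //; have /eqP := qchar_neq0 (2 * l) y0; rewrite sqrf_eq1.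
  by case/orP => /eqP ->; case: e1 => ->.
rewrite big1 => [|y /eqP defv]; last first.
  have y0 : y != 0 by apply: contra v0 => /eqP y0; rewrite -defv y0 expr0n.
  by have := qchar_sqr cardF prim_gamma y0; rewrite defv phiv.
case: eqP => [vl|]; last by rewrite mulr0.
have /eqP := intrE v; rewrite phiv mulnC exprM vl e2 mulrNz.
by rewrite (negPf (oppr1_neq1 cardF prim_gamma)).
Qed.

Lemma card_quartic_class (e : int) : e = 1 \/ e = -1 ->
  #|[set v : F | v ^+ l == e%:~R]| = l.
Proof.
move=> e1; have : 4 * #|[set v : F | v ^+ l == e%:~R]|%:R = 4 * l%:R :> int; last by lia.
rewrite -sum1_card natr_sum big_distrr /= big_mkcond /=.
transitivity (\sum_y (phi y ^+ 2 + e * phi y)); last first.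
  rewrite big_split /= -big_distrr /= (sum_qchar cardF prim_gamma) mulr0 addr0.
  by rewrite sum_qchar_sqr // !natrM mulrA.
rewrite [RHS](partition_big (fun y => y ^+ 2) xpredT) //=; apply: eq_bigr => v _.
by rewrite sum_roots_quartic // inE; case: ifP => _; rewrite ?mulr0.
Qed.

Lemma sum_sqr_scaled_roots (d c : F) : d != 0 -> c != 0 ->
  \sum_(x | x ^+ 2 * c == d) 1 = 1 + phi d * phi c :> int.
Proof.
move=> d0 c0; rewrite -(qcharV cardF prim_gamma c) -phiM.
rewrite -(card_sqr_roots cardF prim_gamma); apply: eq_bigl => x.
by rewrite -[RHS](inj_eq (mulIf c0)) divfK.
Qed.

(** Putting [z = w ^ 2] gives each [z] the weight [1 + phi z], which splits the sum into two sums
    equal to -1. *)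
Lemma sum_qchar_sqrD1 : \sum_w phi w ^+ 2 * phi (w ^+ 2 + 1) = -2.
Proof.
transitivity (\sum_w phi (w ^+ 2) * phi (w ^+ 2 + 1)).
  by apply: eq_bigr => w _; rewrite (phiM w w) expr2.
rewrite (sum_fiber_sqr cardF prim_gamma (fun z => phi z * phi (z + 1))).
have -> : \sum_z (1 + (phi z)%:~R) * (phi z * phi (z + 1)) =
  \sum_z phi z * phi (z + 1) + \sum_z phi z ^+ 2 * phi (z + 1).
  by rewrite -big_split /=; apply: eq_bigr => z _; rewrite intz; ring.
rewrite (sum_qcharM_shift cardF prim_gamma) ?oner_eq0 //.
have -> : \sum_z phi z ^+ 2 * phi (z + 1) = -1; last by [].
have := sum_qchar_shift cardF prim_gamma 1.
rewrite (bigD1 0) //= add0r qchar1 => /(canRL (addKr _)); rewrite addr0 => <-.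
rewrite (bigD1 0) //= qchar0 expr0n mul0r add0r.
by apply: eq_bigr => z z0; rewrite qchar_neq0 // mul1r.
Qed.

(** Representations of [d] as an element of [D_0] plus one of [D_2]; with [l = (q - 1) / 4], the
    [l]-th power tells the quartic classes apart. *)
Definition quartic_reps (d : F) : {set F} :=
  [set u | (u ^+ l == 1) && ((d - u) ^+ l == -1)].

(** In the binomial expansion of [x ^ (2 * l) * (x ^ 2 + 1) ^ (2 * l)], the only exponent
    [2 * l + 2 * j] divisible by [q - 1 = 4 * l] has [j = l]; all other power sums vanish. *)
Lemma jacobsthal1_intr : (S 1)%:~R = - ('C(2 * l, l))%:R :> F.
Proof.
rewrite /jacobsthal rmorph_sum /=.
transitivity (\sum_(x : F) \sum_(j < (2 * l).+1) x ^+ (2 * l + 2 * j) *+ 'C(2 * l, j)).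
  apply: eq_bigr => x _; rewrite intrM !intrE addrC exprDn big_distrr /=.
  by apply: eq_bigr => j _; rewrite expr1n mul1r mulrnAr exprD (exprM _ 2 j).
rewrite exchange_big /=.
have lt_l : (l < (2 * l).+1)%N by lia.
have l_gt0 := quarter_gt0.
rewrite (bigD1 (Ordinal lt_l)) //= [X in _ + X]big1 ?addr0 => [|j jl].
  rewrite sumrMnl (sum_expf cardF prim_gamma); last by lia.
  by rewrite (_ : (2 * l + 2 * l = 2 * (2 * l))%N) ?dvdnn ?mulNrn //; lia.
rewrite sumrMnl (sum_expf cardF prim_gamma); last by lia.
case: ifP => [/dvdnP[m defm]|]; last by rewrite mul0rn.
case/eqP: jl; apply: val_inj => /=; have := ltn_ord j.
by case: m defm => [|[|m]]; nia.
Qed.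

Hypothesis even_l : ~~ odd l.

(* With [u = x ^+ 2], [d - u = y ^+ 2], the conditions read [phi x = 1] and
   [phi y = -1]; then substitute [y = w * x] and sum over [x] first. *)
Lemma card_quartic_reps (d : F) : d != 0 ->
  16 * #|quartic_reps d|%:R = (4 * l)%:R - phi d * (2 + S 1).
Proof.
move=> d0.
(* [A] and [B] are twice the indicators of [phi = 1] and [phi = -1]; with two square roots for each
   of [u] and [d - u], every representation gets total weight 16. *)
pose A x := phi x ^+ 2 + phi x; pose B x := phi x ^+ 2 - phi x.
have sumA v : \sum_(y | y ^+ 2 == v) A y = 4 * (v ^+ l == 1)%:R.
  have := @sum_roots_quartic 1 v (or_introl erefl); rewrite mulr1z => <-.
  by apply: eq_bigr => y _; rewrite mul1r.
have sumB v : \sum_(y | y ^+ 2 == v) B y = 4 * (v ^+ l == -1)%:R.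
  have := @sum_roots_quartic (-1) v (or_intror erefl); rewrite mulrNz mulr1z => <-.
  by apply: eq_bigr => y _; rewrite mulN1r.
pose delta x y : int := (x ^+ 2 + y ^+ 2 == d)%:R.
have -> : 16 * #|quartic_reps d|%:R = \sum_x \sum_y delta x y * (A x * B y).
  rewrite -sum1_card natr_sum big_distrr /= big_mkcond /=.
  rewrite [RHS](partition_big (fun y => y ^+ 2) xpredT) //=; apply: eq_bigr => u _.
  transitivity ((\sum_(x | x ^+ 2 == u) A x) * (\sum_(y | y ^+ 2 == d - u) B y)).
    by rewrite sumA sumB inE; case: (_ == 1); case: (_ == -1) => /=; ring.
  rewrite big_distrl /=; apply: eq_bigr => x /eqP xu.
  rewrite big_distrr /= big_mkcond /=; apply: eq_bigr => y _.
  rewrite /delta xu -(inj_eq (addrI u)) [u + (d - u)]addrC subrK.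
  by case: eqP => _; rewrite ?mul1r ?mul0r.
(* The mixed terms cancel because [delta] is symmetric in [x] and [y]. *)
have -> : \sum_x \sum_y delta x y * (A x * B y) =
    \sum_x \sum_y delta x y * (phi x ^+ 2 * phi y ^+ 2 - phi x * phi y).
  have -> : \sum_x \sum_y delta x y * (A x * B y) =
     \sum_x \sum_y delta x y * (phi x ^+ 2 * phi y ^+ 2 - phi x * phi y) +
     (\sum_x \sum_y delta x y * (phi x * phi y ^+ 2) -
      \sum_x \sum_y delta x y * (phi x ^+ 2 * phi y)).
    rewrite -sumrB -big_split; apply: eq_bigr => x _ /=.
    rewrite -sumrB -big_split; apply: eq_bigr => y _ /=.
    by rewrite /A /B; ring.
  rewrite [X in _ + (X - _)]exchange_big /= [X in _ + X](_ : _ = 0) ?addr0 //.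
  apply/eqP; rewrite subr_eq0; apply/eqP; apply: eq_bigr => x _; apply: eq_bigr => y _.
  by rewrite /delta addrC [phi y * _]mulrC.
have -> : \sum_x \sum_y delta x y * (phi x ^+ 2 * phi y ^+ 2 - phi x * phi y) =
    \sum_x \sum_w (x ^+ 2 * (w ^+ 2 + 1) == d)%:R * B w.
  apply: eq_bigr => x _; have [->|x0] := eqVneq x 0.
    rewrite !big1 // => y _; last by rewrite qchar0; ring.
    by rewrite expr0n mul0r eq_sym (negPf d0) mul0r.
  rewrite (reindex_inj (mulIf x0)); apply: eq_bigr => w _ /=.
  rewrite /delta phiM.
  have -> : x ^+ 2 + (w * x) ^+ 2 = x ^+ 2 * (w ^+ 2 + 1) by ring.
  congr (_ * _); have x2 := qchar_neq0 (2 * l) x0.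
  transitivity (phi x ^+ 2 * phi x ^+ 2 * phi w ^+ 2 - phi x ^+ 2 * phi w); first by ring.
  by rewrite x2 /B; ring.
rewrite exchange_big /=.
transitivity (\sum_w B w * (1 + phi d * phi (w ^+ 2 + 1))).
  apply: eq_bigr => w _; rewrite -big_distrl /= mulrC.
  (* If [w ^ 2 = -1], no [x] solves the equation although the formula would count one; this is
     harmless, since [l] even gives [phi w = 1] and [B w = 0]. *)
  have [w2|w2] := eqVneq (w ^+ 2 + 1) 0; last first.
    congr (_ * _); rewrite -sum_sqr_scaled_roots // [RHS]big_mkcond /=.
    by apply: eq_bigr => x _; case: eqP.
  have -> : B w = 0; last by rewrite !mul0r.
  have phiw : phi w = 1.
    apply/eqP; rewrite qchar_eq; last by left.
    move/eqP: w2; rewrite addr_eq0 exprM => /eqP ->.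
    by rewrite -signr_odd (negPf even_l) expr0.
  by rewrite /B phiw.
have -> : \sum_w B w * (1 + phi d * phi (w ^+ 2 + 1)) =
  \sum_w phi w ^+ 2 - \sum_w phi w + phi d *
    (\sum_w phi w ^+ 2 * phi (w ^+ 2 + 1) - S 1).
  rewrite /jacobsthal -!sumrB big_distrr -big_split; apply: eq_bigr => w _ /=.
  by rewrite /B; ring.
rewrite (sum_qchar cardF prim_gamma) sum_qchar_sqr // sum_qchar_sqrD1 !natrM.
by ring.
Qed.

End QuarticClasses.

(** * The Jacobsthal sum when [q = 1 + 16 * a ^ 2] *)

Section SixteenSquares.
Variables (F : finFieldType) (a : nat) (gamma : F).
Local Notation l := (4 * a ^ 2)%N.
Hypothesis cardF : #|F| = (2 * (2 * l)).+1.
Hypothesis prim_gamma : (2 * (2 * l)).-primitive_root gamma.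

Local Notation phi := (@qchar F (2 * l)).
Local Notation S := (@jacobsthal F (2 * l)).

Let even_l : ~~ odd l.
Proof. by rewrite oddM. Qed.

Lemma jacobsthal1_eq : S 1 = -2.
Proof.
have [p p_pr chF] := finPcharP F.
have [n cardFp] : exists n, #|F| = (p ^ n)%N.
  by exists (logn p #|F|); exact: (card_pprimeChar chF).
have p2 : p != 2%N.
  apply/eqP => p2; have := natr2_neq0 cardF prim_gamma.
  by rewrite -(dvdn_pcharf chF) p2.
have p_odd : odd p by case: (even_prime p_pr) p2 => [->|].
have pq : (p %| (4 * a) ^ 2 + 1)%N.
  rewrite (_ : (4 * a) ^ 2 + 1 = #|F|)%N; last by rewrite cardF expnMn; lia.
  by rewrite (dvdn_pcharf chF) natr_cardF.
have p4 := pchar_dvd_sqrD1_mod4 chF p_odd pq.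
have pS : ~~ (p%:Z %| S 1%R)%Z.
  apply/negP => /dvdzP[m defS].
  have /eqP := jacobsthal1_intr cardF prim_gamma.
  rewrite defS intrM -pmulrn (pcharf0 chF) mulr0 eq_sym oppr_eq0.
  rewrite -(dvdn_pcharf chF); apply/negP.
  by apply: (prime_ndvd_central_bin p_pr p4 (n := n)); rewrite -cardFp cardF; lia.
(* The count [r] of representations of 1 satisfies [16 * r = 16 * a ^ 2 - 2 - S 1], so
   [c = a ^ 2 - r]. *)
have [c defS] : exists c : int, S 1 = 2 * (8 * c - 1).
  have := card_quartic_reps cardF prim_gamma even_l (oner_neq0 F).
  rewrite qchar1 mul1r; move: (S 1) #|_| => s r; rewrite !natrM.
  by exists ((a ^ 2)%N%:Z - r%:Z); lia.
have even_h : ~~ odd (2 * l) by rewrite oddM.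
have := jacobsthal_sum_squares cardF prim_gamma even_h.
rewrite -cardF cardFp defS => sumS.
have [t defT] : exists t : int, S gamma = 2 * t.
  exists (S gamma %/ 2)%Z; move: sumS; clear; move: (S gamma) (p ^ n)%N => T Q.
  have := divz_eq T 2; have := modz_ge0 T (isT : 2 != 0 :> int).
  have := ltz_pmod T (isT : 0 < 2 :> int).
  move: (T %/ 2)%Z (T %% 2)%Z => t r r2 r0 defT sumS.
  have [r_0|r_1] : r = 0 \/ r = 1 by lia.
    by rewrite defT r_0; lia.
  move: sumS; rewrite defT r_1 !expr2; lia.
have st : (8 * c - 1) ^+ 2 + t ^+ 2 = (p ^ n)%N%:Z.
  by move: sumS; rewrite defT !expr2; lia.
have qb : (p ^ n)%N%:Z = 1 + (4 * a%:Z) ^+ 2 by rewrite -cardFp cardF expr2; lia.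
have np2 : ~~ (p%:Z %| 2)%Z by rewrite dvdzE /= dvdn_prime2.
have nps : ~~ (p%:Z %| 8 * c - 1)%Z by apply: contra pS => ps; rewrite defS dvdz_mull.
(* Among [8 * c - 1 = 1] and [8 * c - 1 = -1] only the latter is possible, with [c = 0]; the square
   of [4 * a] is excluded by parity. *)
case: (sum_two_squares_unique p_pr qb st np2 nps).
  move/eqP; rewrite sqrf_eq1 => /orP[] /eqP c1; move: c1; clear; lia.
rewrite !expr2; clear; lia.
Qed.

Lemma card_quartic_reps_const (d : F) : #|quartic_reps l d| = if d == 0 then 0%N else (a ^ 2)%N.
Proof.
case: eqVneq => [->|d0].
  (* As [l] is even, [u] and [- u] have the same [l]-th power, so 0 has no representation. *)
  apply/eqP; rewrite cards_eq0; apply/eqP/setP => u; rewrite !inE sub0r.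
  rewrite exprNn -signr_odd (negPf even_l) expr0 mul1r; apply/negP.
  by case/andP => /eqP -> /eqP/esym/eqP; rewrite (negPf (oppr1_neq1 cardF prim_gamma)).
have := card_quartic_reps cardF prim_gamma even_l d0.
by rewrite jacobsthal1_eq; lia.
Qed.

End SixteenSquares.

(** * Counting pairs coordinate by coordinate *)

Lemma card_set_pair1 (A B : finType) (P : pred (A * B)) :
  #|[set z | P z]| = (\sum_x #|[set y | P (x, y)]|)%N.
Proof.
rewrite -sum1_card (eq_bigl P) => [|z]; last by rewrite inE.
rewrite (eq_bigl (fun z => P (z.1, z.2))) => [|[]//].
rewrite -(pair_big_dep xpredT (fun x y => P (x, y)) (fun _ _ => 1%N)) /=.
by apply: eq_bigr => x _; rewrite -sum1_card; apply: eq_bigl => y; rewrite inE.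
Qed.

Lemma card_set_pair2 (A B : finType) (P : pred (A * B)) :
  #|[set z | P z]| = (\sum_y #|[set x | P (x, y)]|)%N.
Proof.
have swap_inj : injective (fun z : B * A => (z.2, z.1)) by move=> [? ?] [? ?] [-> ->].
rewrite -(card_set_pair1 (fun z : B * A => P (z.2, z.1))).
rewrite -(card_imset _ swap_inj); apply: eq_card => -[x y]; rewrite !inE.
apply/idP/imsetP => [Pxy|[[y' x']]]; first by exists (y, x); rewrite ?inE.
by rewrite inE => Pxy [-> ->].
Qed.

(** * Arcs and 2-paths of the Cayley digraph *)

Section CayleyGraph.
Variables (F : finFieldType) (a : nat) (gamma : F).
Local Notation l := (4 * a ^ 2)%N.
Hypothesis a_gt0 : (0 < a)%N.
Hypothesis cardF : #|F| = (2 * (2 * l)).+1.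
Hypothesis prim_gamma : (2 * (2 * l)).-primitive_root gamma.

(** The type ['Z_l] has exactly [l] elements only for [l > 1]. *)
Let l_gt1 : (1 < l)%N.
Proof. by case: a a_gt0 => // b _; nia. Qed.

Let even_l : ~~ odd l.
Proof. by rewrite oddM. Qed.

(** As [gamma] has order [4 * l] and [gamma ^ (2 * l) = -1], the [l]-th power of [gamma ^ i] is -1
    exactly when [i] is 2 mod 4. *)
Lemma cyc_class42E (x : F) : (x \in cyc_class gamma 4 2) = (x ^+ l == -1).
Proof.
rewrite inE; apply/existsP/idP => [[k /eqP ->]|xl].
  rewrite -exprM mulnDl exprD expr_prim_half //.
  rewrite (_ : (4 * k * l = 2 * (2 * l) * k)%N); last by lia.
  by rewrite exprM (prim_expr_order prim_gamma) expr1n mulr1.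
have x0 : x != 0.
  apply: contraTneq xl => ->.
  by rewrite expr0n (gtn_eqF (ltnW l_gt1)) eq_sym oppr_eq0 oner_eq0.
have [[i lti] /= defx] := prim_rootP prim_gamma (expf_cardB1 cardF x0).
move: xl; rewrite defx -(expr_prim_half cardF prim_gamma) -exprM.
rewrite (eq_prim_root_expr prim_gamma) => /eqP il.
have i4 : (i %% 4 = 2)%N.
  move: il; rewrite (_ : (2 * (2 * l) = 4 * l)%N) -?muln_modl; last by lia.
  by move/eqP; rewrite eqn_pmul2r 1?ltnW // => /eqP.
have lt_k : (i %/ 4 < #|F|)%N by rewrite cardF; move: lti; lia.
by exists (Ordinal lt_k); apply/eqP; congr (_ ^+ _) => /=; lia.
Qed.

Let ltn_Zl (i : 'Z_l) : (i < l)%N.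
Proof. by have := ltn_ord i; rewrite [X in (_ < X)%N]Zp_cast. Qed.

Definition zexp (i : 'Z_l) : F := gamma ^+ (4 * i).

Lemma zexp_quartic (i : 'Z_l) : zexp i ^+ l = 1.
Proof.
rewrite /zexp -exprM (_ : (4 * i * l = 2 * (2 * l) * i)%N); last by lia.
by rewrite exprM (prim_expr_order prim_gamma) expr1n.
Qed.

Lemma zexp_neq0 (i : 'Z_l) : zexp i != 0.
Proof. by rewrite expf_neq0 // (prim_neq0 cardF prim_gamma). Qed.

Lemma zexpN (i : 'Z_l) : zexp (- i) = (zexp i)^-1.
Proof.
apply: (mulIf (zexp_neq0 i)); rewrite mulVf ?zexp_neq0 // /zexp.
have g4 : (gamma ^+ 4) ^+ l = 1.
  by rewrite -exprM -(prim_expr_order prim_gamma); congr (_ ^+ _); lia.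
rewrite !exprM /= [in X in (_ %% X)%N]Zp_cast // expr_mod // -exprD subnK //.
  by rewrite Zp_cast.
exact: ltnW (ltn_ord i).
Qed.

Lemma zexp_inj : injective zexp.
Proof.
move=> i j /eqP; rewrite /zexp (eq_prim_root_expr prim_gamma) => /eqP ij.
have lti := ltn_Zl i; have ltj := ltn_Zl j.
apply: val_inj; move: ij; rewrite !modn_small /=; lia.
Qed.

Lemma card_Zl : #|{: 'Z_l}| = l.
Proof. by rewrite card_ord Zp_cast. Qed.

(** An injection of the [l] indices into [D_0], which has [l] elements, is onto. *)
Lemma zexp_onto (u : F) : u ^+ l = 1 -> exists i, u = zexp i.
Proof.
have im : zexp @: setT = [set v : F | v ^+ l == 1%:~R].
  apply/eqP; rewrite eqEcard (card_quartic_class cardF prim_gamma); last by left.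
  rewrite card_imset; last exact: zexp_inj.
  rewrite cardsT card_Zl leqnn andbT.
  by apply/subsetP => v /imsetP[i _ ->]; rewrite inE zexp_quartic.
move=> ul; have : u \in [set v : F | v ^+ l == 1%:~R] by rewrite inE ul.
by rewrite -im => /imsetP[i _ ->]; exists i.
Qed.

(** Since [l] is even, [u = - zexp m] runs once over [D_0], and [e + zexp m = e - u]: these are the
    representations of [e]. *)
Lemma card_zexp_shift (e : F) :
  #|[set m : 'Z_l | (e + zexp m) ^+ l == -1]| = if e == 0 then 0%N else (a ^ 2)%N.
Proof.
rewrite -(card_quartic_reps_const cardF prim_gamma).
have zexpN_inj : injective (fun m => - zexp m) by move=> i j /oppr_inj/zexp_inj.
have oppl (x : F) : (- x) ^+ l = x ^+ l.
  by rewrite exprNn -signr_odd (negPf even_l) expr0 mul1r.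
rewrite -(card_imset _ zexpN_inj); apply: eq_card => u; rewrite [in RHS]inE.
apply/imsetP/andP => [[m]|[/eqP ul eul]].
  by rewrite inE => em ->; rewrite oppl zexp_quartic opprK.
have /zexp_onto[m defu] : (- u) ^+ l = 1 by rewrite oppl.
by exists m; rewrite -?defu ?opprK // inE -defu.
Qed.

Lemma card_class2_preim (f : F -> F) : injective f ->
  #|[set y | f y ^+ l == -1]| = l.
Proof.
move=> f_inj; have := card_quartic_class cardF prim_gamma (or_intror erefl).
rewrite mulrNz mulr1z => {2}<-; rewrite -[RHS](card_preimset _ f_inj).
by apply: eq_card => y; rewrite !inE.
Qed.

Variable E : {set F * 'Z_l}.
Hypothesis defE : E = [set g | g.1 \in [set -1 + x | x in cyc_class gamma 4 2]].

(** Undoing the shift by -1 in the connection set leaves [1 + (h.1 - g.1) / zexp g.2]; multiplying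
    by [zexp g.2], an element of [D_0], does not change the quartic class. *)
Lemma cay_arcE (g h : F * 'Z_l) :
  cay_arc gamma E g h = ((h.1 - g.1 + zexp g.2) ^+ l == -1).
Proof.
rewrite /cay_arc defE inE /=.
have -> : forall y, (y \in [set -1 + x | x in cyc_class gamma 4 2]) =
    (1 + y \in cyc_class gamma 4 2).
  move=> y; apply/imsetP/idP => [[x x2 ->]|y2]; first by rewrite addNKr.
  by exists (1 + y); rewrite ?addKr.
rewrite cyc_class42E -/(zexp (- g.2)) -/(zexp g.2) zexpN.
have -> : 1 + (- (zexp g.2)^-1 * g.1 + (zexp g.2)^-1 * h.1) =
   (zexp g.2)^-1 * (h.1 - g.1 + zexp g.2).
  by have := zexp_neq0 g.2; move: (zexp g.2) => c c0; field.
by rewrite exprMn exprVn zexp_quartic invr1 mul1r.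
Qed.

(** With [d = y.1 - x.1 + zexp x.2], a middle vertex is given by [u] in [D_2] and an index [m] with
    [d - u + zexp m] in [D_2]. Each of the [l] values of [u] allows [a ^ 2] indices, except [u = d],
    which allows none and occurs exactly when there is an arc. *)
Lemma card_two_paths (x y : F * 'Z_l) :
  #|[set z | cay_arc gamma E x z && cay_arc gamma E z y]| =
  ((l - cay_arc gamma E x y) * a ^ 2)%N.
Proof.
rewrite card_set_pair1 cay_arcE.
transitivity (\sum_(u : F | (u ^+ l == -1)%R)
  if (y.1 - x.1 + zexp x.2 == u)%R then 0 else a ^ 2)%N.
  rewrite (reindex_inj (addrI (x.1 - zexp x.2))) [RHS]big_mkcond /=.
  apply: eq_bigr => u _.
  under eq_finset => m do rewrite !cay_arcE /=.
  have -> : x.1 - zexp x.2 + u - x.1 + zexp x.2 = u by ring.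
  case: (u ^+ l == -1) => /=; last by apply: eq_card0 => m; rewrite inE.
  rewrite card_zexp_shift -[_ == u]subr_eq0; congr (if _ == _ then _ else _).
  by ring.
set d := y.1 - x.1 + zexp x.2.
have card2 : #|[pred u : F | u ^+ l == -1]| = l.
  by rewrite -[RHS](card_class2_preim (@inj_id F)) cardsE.
have [dl|dl] := boolP (d ^+ l == -1).
  rewrite (bigD1 d) //= eqxx add0n.
  rewrite (eq_bigr (fun _ => a ^ 2)%N) => [|u /andP[_ ud]]; last by rewrite eq_sym (negPf ud).
  rewrite sum_nat_const; congr (_ * _)%N.
  move: card2; rewrite (cardD1 d) inE dl add1n => card2.
  rewrite -[X in (X - _)%N]card2 subSS subn0.
  by apply: eq_card => u; rewrite !inE andbC.
rewrite (eq_bigr (fun _ => a ^ 2)%N) => [|u ul]; last first.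
  by case: eqP => // du; rewrite du ul in dl.
by rewrite sum_nat_const card2 subn0.
Qed.

Lemma cay_arc_dsrg : is_dsrg (cay_arc gamma E)
  (#|F| * l) (l ^ 2) (l * a ^ 2) (l * a ^ 2 - a ^ 2) (l * a ^ 2).
Proof.
have irr x : ~~ cay_arc gamma E x x.
  by rewrite cay_arcE subrr add0r zexp_quartic eq_sym (oppr1_neq1 cardF prim_gamma).
split=> //.
- by rewrite card_prod card_Zl.
- move=> x; rewrite card_set_pair2.
  under eq_bigr => j _.
    under eq_finset => y do rewrite cay_arcE /=.
    rewrite card_class2_preim; last by move=> y z /addIr/addIr.
    over.
  by rewrite sum_nat_const card_Zl mulnn.
- move=> y; rewrite card_set_pair2.
  under eq_bigr => j _.
    under eq_finset => x do rewrite cay_arcE /=.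
    rewrite card_class2_preim; last by move=> x z /addIr/addrI/oppr_inj.
    over.
  by rewrite sum_nat_const card_Zl mulnn.
move=> x y; rewrite card_two_paths; case: eqP => [->|_].
  by rewrite (negPf (irr y)) subn0.
by case: (cay_arc gamma E x y); rewrite ?subn0 // mulnBl mul1n.
Qed.

End CayleyGraph.

(** * The parameters in terms of [q] *)

Unset Implicit Arguments.

Theorem mainTheorem5 (F : finFieldType) (a : nat) (gamma : F)
  (ha : (0 < a)%N)
  (hq : #|F| = (1 + 16 * a ^ 2)%N)
  (hgamma : (#|F|.-1).-primitive_root gamma) :
  let q := #|F| in
  let l := ((q - 1) %/ 4)%N in
  let S : {set F} := [set -1 + x | x in cyc_class gamma 4 2] in
  let E : {set F * 'Z_l} := [set g | g.1 \in S] in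
  is_dsrg (cay_arc gamma E)
    (q * (q - 1) %/ 4)%N
    (((q - 1) %/ 4) ^ 2)%N
    (((q - 1) %/ 8) ^ 2)%N
    (((q - 1) %/ 8) ^ 2 - (q - 1) %/ 16)%N
    (((q - 1) %/ 8) ^ 2)%N.
Proof.
move=> q l S.
have def_q1 : (q - 1 = 16 * a ^ 2)%N by rewrite /q hq addKn.
have def_l : l = (4 * a ^ 2)%N by rewrite /l def_q1; lia.
have -> : (q * (q - 1) %/ 4 = q * (4 * a ^ 2))%N.
  by rewrite def_q1 (_ : 16 * a ^ 2 = 4 * a ^ 2 * 4)%N ?mulnA ?mulnK //; lia.
(* Here [(q - 1) / 8 = 2 * a ^ 2], whose square is [l * a ^ 2]. *)
have -> : (((q - 1) %/ 8) ^ 2 = 4 * a ^ 2 * a ^ 2)%N.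
  by rewrite def_q1 (_ : 16 * a ^ 2 = 2 * a ^ 2 * 8)%N ?mulnK //; lia.
have -> : ((q - 1) %/ 16 = a ^ 2)%N by rewrite def_q1 mulKn.
rewrite -/l def_l => E.
apply: cay_arc_dsrg => //; first by rewrite hq; lia.
by move: hgamma; rewrite hq; congr (_.-primitive_root gamma); lia.
Qed.
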